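(* Let $N \ge 1$, let $y$ be a positive integer with $\phi^N(y) = y$ (i.e. $y$ lies on a periodic orbit of the accelerated Collatz map $\phi$ of period $N$), let $d \in \{0,1\}^N$ be the parity word of $y, \phi(y), \dots, \phi^{N-1}(y)$, and let $r$ be the number of ones in $d$. Suppose that $N/r > \log_2 3$ (in particular $r \ge 1$). Then there exists an element $x$ of the orbit $\{y,\phi(y),\dots,\phi^{N-1}(y)\}$ satisfying $$x \le \frac{1}{2^{N/r} - 3}.$$
   Context: The accelerated Collatz map on the positive integers is $\phi(x) = x/2$ if $x$ is even and $\phi(x) = (3x+1)/2$ if $x$ is odd; $\phi^k$ is its $k$-th iterate. The parity word of length $N$ of the orbit of $y$ is $d=(d_1,\dots,d_N)$ with $d_i = 1$ if $\phi^{i-1}(y)$ is odd and $d_i = 0$ if $\phi^{i-1}(y)$ is even. Here $2^{N/r}$ is a real power with real exponent $N/r$. *)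

(* Defs.v *)
From mathcomp Require Import all_boot all_order all_algebra.
From mathcomp Require Import all_classical all_reals all_analysis.

Set Implicit Arguments.
Unset Strict Implicit.
Unset Printing Implicit Defensive.

Import Order.TTheory GRing.Theory Num.Theory.

(* The positive integers are represented by [nat] together with a positivity
   hypothesis; [collatz] maps positive numbers to positive numbers. *)
Definition collatz (x : nat) : nat :=
  if odd x then (3 * x + 1)./2 else x./2.

(* [true] stands for the letter 1 and [false] for the letter 0; positions are
   numbered from 0, so the entry at [i] is d_(i+1). *)
Definition parity_word (N y : nat) : N.-tuple bool :=
  [tuple odd (iter i collatz y) | i < N].

Definition log2 (R : realType) (x : R) : R := (ln x / ln 2)%R.

(* Main.v *)
(** Multiplying the relations [2 phi(x) = x] (x even) and [2 phi(x) = (3 + 1/x) x]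
    (x odd) along the cycle gives [2^N = \prod (3 + 1/x)] over the [r] odd
    elements [x] of the orbit, so some factor is at least [2^(N/r)]. *)
Require Import Defs.
From mathcomp Require Import all_boot all_order all_algebra.
From mathcomp Require Import all_classical all_reals all_analysis.

Set Implicit Arguments.
Unset Strict Implicit.
Unset Printing Implicit Defensive.

Import Order.TTheory GRing.Theory Num.Theory.
Local Open Scope ring_scope.

Lemma double_collatz (x : nat) :
  (2 * collatz x = if odd x then 3 * x + 1 else x)%N.
Proof.
rewrite /collatz mul2n; case: ifPn => ox; apply: even_halfK => //.
by rewrite oddD oddM ox.
Qed.

(** Counting over a prefix of arbitrary length [k] permits induction along the orbit. *)
Definition odd_steps (y k : nat) : nat :=
  count (fun i => odd (iter i collatz y)) (iota 0 k).

Lemma odd_stepsS (y k : nat) :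
  odd_steps y k.+1 = (odd_steps y k + odd (iter k collatz y))%N.
Proof. by rewrite /odd_steps -addn1 iotaD count_cat /= addn0. Qed.

Lemma count_parity_word (N y : nat) :
  count_mem true (parity_word N y) = odd_steps y N.
Proof.
rewrite /= count_map /odd_steps -val_enum_ord count_map.
by apply: eq_count => i /=; rewrite eqb_id.
Qed.

(** An even step halves exactly, while an odd step multiplies by (3x+1)/(2x) < c/2; hence a single
    odd step already makes the bound strict. *)
Lemma collatz_growth (R : realFieldType) (c : R) (y n : nat) :
  0 < c ->
  (forall i, (i < n)%N ->
    3 * (iter i collatz y)%:R + 1 < c * (iter i collatz y)%:R) ->
  2 ^+ n * (iter n collatz y)%:R < c ^+ odd_steps y n * y%:R
    ?<= if (odd_steps y n == 0)%N.
Proof.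
move=> c0; elim: n => [|n IHn] hc; first by rewrite /= !expr0 lexx.
have /IHn {}IHn i : (i < n)%N ->
    3 * (iter i collatz y)%:R + 1 < c * (iter i collatz y)%:R.
  by move=> /ltnW; apply: hc.
rewrite odd_stepsS iterS exprSr -mulrA -natrM double_collatz.
case: ifPn => [_|_]; last by rewrite addn0.
rewrite (addn1 (odd_steps y n)) exprSr (mulrC _ c) -mulrA natrD natrM.
(* Strictness comes from the current odd step, so the weak form of [IHn] suffices. *)
apply: (@lt_le_trans _ _ (2 ^+ n * (c * (iter n collatz y)%:R))).
  by rewrite ltr_pM2l ?exprn_gt0 ?hc.
rewrite mulrCA ler_pM2l //; exact: lteifW IHn.
Qed.

Theorem theorem8p2 (R : realType) (N y : nat) (d : N.-tuple bool) (r : nat)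
    (hN : (1 <= N)%N) (hy : (0 < y)%N) (hper : iter N collatz y = y)
    (hd : d = parity_word N y) (hr : r = count_mem true d)
    (hNr : log2 3 < N%:R / r%:R :> R) :
  exists2 x : nat, x \in traject collatz y N &
    x%:R <= 1 / (2 `^ (N%:R / r%:R) - 3) :> R.
Proof.
rewrite hd count_parity_word in hr.
have ln2 : 0 < ln 2 :> R by rewrite ln_gt0 // ltr1n.
have ln3 : 0 < ln 3 :> R by rewrite ln_gt0 // ltr1n.
(* For r = 0 the junk value N / 0 = 0 contradicts [hNr]. *)
have r0 : r != 0%N.
  apply: contraTneq hNr => ->.
  by rewrite invr0 mulr0 -leNgt /log2 divr_ge0 ?ltW.
set c : R := 2 `^ _.
have c3 : 3 < c.
  rewrite -ltr_ln ?posrE ?powR_gt0 // ln_powR.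
  by rewrite -ltr_pdivrMr.
(* [c] is the r-th root of 2^N, the geometric mean of the factors 3 + 1/x. *)
have cr : c ^+ r = 2 ^+ N.
  by rewrite -powR_mulrn ?powR_ge0 // -powRrM divfK ?pnatr_eq0 // powR_mulrn.
apply: contrapT => no_small.
(* As c - 3 > 0, failure of the bound, 1/(c-3) < x, rearranges to 3x + 1 < cx. *)
have hc i : (i < N)%N ->
    3 * (iter i collatz y)%:R + 1 < c * (iter i collatz y)%:R.
  move=> iN; rewrite addrC -ltrBrDr -mulrBl mulrC -ltr_pdivrMr ?subr_gt0 //.
  rewrite ltNge; apply/negP => le_x; apply: no_small.
  by exists (iter i collatz y) => //; apply/trajectP; exists i.
have c0 : 0 < c by rewrite powR_gt0.
(* Around the full cycle, r > 0 selects the strict case: 2^N y < 2^N y. *)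
have := collatz_growth c0 hc.
by rewrite -hr (negPf r0) hper cr /= ltxx.
Qed.
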